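(* Let $n,x,k$ be integers with $n>x\ge k\ge 3$. Then $$P_{n+1}(x,k)=\sum_{j=\left\lfloor \frac{n-k-1}{n-x}\right\rfloor}^{k}P_{n-k}(x-k,j).$$
   Context: For integers $m\ge 0$ and $y,j\ge 0$, $B_m^{y,j}$ denotes the set of binary strings of length $m$ that contain exactly $y$ zeros and in which the longest block of consecutive zeros has length exactly $j$ (the all-ones string, including the empty string, lies in $B_m^{0,0}$). For a binary string $X$, let $X_l$ be the multiset of lengths of the maximal blocks of consecutive zeros of $X$. Two strings $X,Y\in B_m^{y,j}$ are equivalent if $X_l=Y_l$. $P_{m+1}(y,j)$ denotes the number of equivalence classes of $B_m^{y,j}$ under this relation (equivalently, the number of distinct multisets $X_l$ for $X\in B_m^{y,j}$; these correspond to partitions of $m+1$). *)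

(* Defs.v *)
From HB Require Import structures.
From mathcomp Require Import all_boot.

Set Implicit Arguments.
Unset Strict Implicit.
Unset Printing Implicit Defensive.

(* Binary strings are boolean sequences, with false for 0 and true for 1.     *)

(* [c] counts the zeros of the block that is being read; a block is recorded  *)
(* when it is closed by a one or by the end of the string.                    *)
Fixpoint zero_runs_from (c : nat) (s : seq bool) : seq nat :=
  match s with
  | [::] => if c == 0 then [::] else [:: c]
  | false :: s' => zero_runs_from c.+1 s'
  | true :: s' =>
      if c == 0 then zero_runs_from 0 s' else c :: zero_runs_from 0 s'
  end.

(* The lengths of the maximal blocks of zeros, from left to right; the        *)
(* multiset X_l is this sequence up to perm_eq.                               *)
Definition zero_runs (s : seq bool) : seq nat := zero_runs_from 0 s.

Definition longest_zero_run (s : seq bool) : nat := \max_(l <- zero_runs s) l.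

Definition B (m y j : nat) : {set m.-tuple bool} :=
  [set X : m.-tuple bool | (count_mem false X == y)
                           & (longest_zero_run X == j)].

Definition same_zero_runs (m : nat) : rel (m.-tuple bool) :=
  fun X Y => perm_eq (zero_runs X) (zero_runs Y).

(* P N counts classes of strings of length N - 1; it is meaningful for        *)
(* 0 < N only.                                                                *)
Definition P (N y j : nat) : nat :=
  #|equivalence_partition (@same_zero_runs N.-1) (B N.-1 y j)|.

(* Main.v *)
Require Import Defs.
From HB Require Import structures.
From mathcomp Require Import all_boot.
From mathcomp Require Import zify.

(** A class of strings of length m with y zeros is a multiset of positive
    integers with sum y and at most m - y + 1 elements, since m - y ones
    separate at most m - y + 1 blocks; conversely every such multiset occurs.
    Removing one copy of the maximum k from the multisets counted by
    P_{n+1}(x, k) leaves exactly the multisets with sum x - k, at most n - x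
    elements and maximum j <= k. As the sum is at most n - x times the maximum,
    j is at least the ceiling of (x - k) / (n - x), which is the lower
    summation bound. *)

Lemma zero_runs_from_gt0 c s : 0 \notin zero_runs_from c s.
Proof.
elim: s c => [|[] s IH] [|c] //=; rewrite inE /=; exact: IH.
Qed.

Lemma sumn_zero_runs_from c s :
  sumn (zero_runs_from c s) = c + count_mem false s.
Proof.
elim: s c => [|[] s IH] [|c] //=; rewrite ?IH //=; lia.
Qed.

(** Each one closes at most one block, and the end of the string at most one more. *)
Lemma size_zero_runs_from c s :
  size (zero_runs_from c s) <= (count_mem true s).+1.
Proof.
elim: s c => [|[] s IH] [|c] //=; rewrite ?add1n ?ltnS ?IH //.
by apply: leq_trans (IH 0) _.
Qed.

Lemma zero_runs_from_nseq c a s :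
  zero_runs_from c (nseq a false ++ s) = zero_runs_from (c + a) s.
Proof. by elim: a c => [|a IH] c /=; rewrite ?addn0 // IH addSnnS. Qed.

Lemma zero_runs_ones r : zero_runs (nseq r true) = [::].
Proof. by rewrite /zero_runs; elim: r. Qed.

(* A string with zero runs [s] and [r] ones; it is too short to hold all of [s]
   when [size s > r.+1]. *)
Fixpoint string_of_runs (s : seq nat) (r : nat) : seq bool :=
  if s is a :: s' then
    nseq a false ++ (if r is r'.+1 then true :: string_of_runs s' r' else [::])
  else nseq r true.

Lemma zero_runs_string s r :
  0 \notin s -> size s <= r.+1 -> zero_runs (string_of_runs s r) = s.
Proof.
elim: s r => [|a s IH] r; first by rewrite zero_runs_ones.
rewrite inE negb_or eq_sym -lt0n /= => /andP[a_gt0 s0] le_s.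
rewrite /zero_runs zero_runs_from_nseq add0n.
case: r le_s => [|r] /= le_s; rewrite -[a == 0]negbK -lt0n a_gt0 /=.
  (* Without a one left to act as separator, the length bound forces the remaining runs to be
     empty. *)
  by case: s s0 le_s {IH}.
by congr cons; apply: IH.
Qed.

Lemma size_string s r :
  size s <= r.+1 -> size (string_of_runs s r) = sumn s + r.
Proof.
elim: s r => [|a s IH] r /=; first by rewrite size_nseq.
rewrite size_cat size_nseq; case: r => [|r] /= le_s; last by rewrite IH //; lia.
by case: s le_s {IH} => //=; lia.
Qed.

(** The number of distinct values of a map depends only on which points it identifies. *)
Lemma size_undup_map_eq (T1 T2 T3 : eqType) (f : T1 -> T2) (g : T1 -> T3)
    (s : seq T1) :
    {in s &, forall x y, (f x == f y) = (g x == g y)} ->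
  size (undup (map f s)) = size (undup (map g s)).
Proof.
elim: s => //= x s IH fg.
have -> : (f x \in map f s) = (g x \in map g s).
  rewrite -!has_pred1 !has_map; apply: eq_in_has => y ys /=.
  by apply: fg; rewrite inE ?eqxx ?ys ?orbT.
have {}IH : size (undup (map f s)) = size (undup (map g s)).
  by apply: IH => y z ys zs; apply: fg; rewrite inE ?ys ?zs orbT.
by case: ifP => _ /=; rewrite IH.
Qed.

Lemma card_imset_undup (aT rT : finType) (f : aT -> rT) (D : {set aT}) :
  #|f @: D| = size (undup (map f (enum D))).
Proof.
rewrite -(card_uniqP (undup_uniq _)); apply: eq_card => y.
rewrite mem_undup; apply/imsetP/mapP => -[x xD ->]; exists x => //.
  by rewrite mem_enum.
by rewrite -mem_enum.
Qed.

(** Each point of [D] lies in its own class, so two points have the same class exactly when [f]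
    agrees on them. Counting classes thus becomes counting values of an invariant. *)
Lemma card_equivalence_partition_undup (T : finType) (rT : eqType)
    (f : T -> rT) (R : rel T) (D : {set T}) :
    (forall x y, R x y = (f x == f y)) ->
  #|equivalence_partition R D| = size (undup (map f (enum D))).
Proof.
move=> Rf; rewrite card_imset_undup; apply: size_undup_map_eq => x y.
rewrite !mem_enum => xD yD; apply/eqP/eqP => [/setP/(_ y) | fxy].
  by rewrite !inE yD !Rf eqxx => /eqP.
by apply/setP => z; rewrite !inE !Rf fxy.
Qed.

Lemma geq_total : total geq.
Proof. by move=> a b; apply: leq_total. Qed.

Lemma geq_trans : transitive geq.
Proof. by move=> a b c /= ba ac; apply: leq_trans ac ba. Qed.

Lemma geq_anti : antisymmetric geq.
Proof. by move=> a b /andP[ba ab]; apply/anti_leq/andP. Qed.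

(** Nonincreasing order gives one canonical sequence per multiset and puts the largest block at the
    head, so that removing it is [behead]. *)
Definition run_types (m y j : nat) : seq (seq nat) :=
  undup [seq sort geq (zero_runs X) | X : m.-tuple bool <- enum (B m y j)].

Lemma P_run_types m y j : P m.+1 y j = size (run_types m y j).
Proof.
apply: card_equivalence_partition_undup => X Y.
by apply/(perm_sortP geq_total geq_trans geq_anti)/eqP.
Qed.

Definition run_type (y r j : nat) (s : seq nat) : bool :=
  [&& sorted geq s, 0 \notin s, sumn s == y, size s <= r.+1 &
      \max_(l <- s) l == j].

Lemma mem_run_types m y j s :
  y <= m -> (s \in run_types m y j) = run_type y (m - y) j s.
Proof.
move=> le_ym; rewrite mem_undup; apply/mapP/idP => [[X] | ].
  rewrite mem_enum inE => /andP[/eqP cX /eqP mX] ->.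
  have pX := permEl (perm_sort geq (zero_runs X)).
  rewrite /run_type sort_sorted ?mem_sort; last exact: geq_total.
  rewrite zero_runs_from_gt0 (perm_sumn pX) sumn_zero_runs_from cX eqxx.
  rewrite (perm_big _ pX) -/(longest_zero_run X) mX eqxx andbT /= size_sort.
  have := size_zero_runs_from 0 X; rewrite /zero_runs.
  have <- : count_mem true X = m - y; last by [].
  have := count_predC (pred1 false) X; rewrite cX size_tuple => cXm.
  by rewrite -[in RHS]cXm addKn; apply: eq_count => -[].
case/and5P=> srt s0 /eqP sum_s sz_s /eqP max_s.
have szX : size (string_of_runs s (m - y)) == m.
  by rewrite size_string // sum_s subnKC.
have runsX := zero_runs_string _ _ s0 sz_s.
exists (Tuple szX); last by rewrite /= runsX sorted_sort //; apply: geq_trans.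
rewrite mem_enum inE /longest_zero_run /= runsX max_s eqxx andbT.
by rewrite -[count_mem _ _]add0n -sumn_zero_runs_from -/(zero_runs _) runsX sum_s.
Qed.

Lemma sumn_leq_size_max s : sumn s <= size s * \max_(l <- s) l.
Proof.
elim: s => //= a s IH; rewrite big_cons mulSn.
apply: leq_add (leq_maxl _ _) (leq_trans IH _).
by rewrite leq_mul2l leq_maxr orbT.
Qed.

Lemma size_sum_count (T : eqType) (s : seq T) (f : T -> nat) (a b : nat) :
    {in s, forall x, a <= f x < b} ->
  size s = \sum_(a <= j < b) count (fun x => f x == j) s.
Proof.
move=> fab; rewrite -sum1_size.
under [RHS]eq_bigr => j _ do rewrite -sum1_count big_mkcond.
rewrite exchange_big /=; apply: eq_big_seq => x xs.
under eq_bigr => j _ do rewrite eq_sym.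
by rewrite -big_mkcond big_nat1_eq fab.
Qed.

Lemma sorted_geq_cons k s :
  sorted geq (k :: s) = (\max_(l <- s) l <= k) && sorted geq s.
Proof.
rewrite /= path_sortedE; last exact: geq_trans.
by congr andb; apply/allP/bigmax_leqP_seq => H l ls => [_|]; apply: H.
Qed.

(** The hypothesis [k <= y] keeps [y - k] from being truncated. The maximum of the tail is left
    free, to become the summation index. *)
Lemma run_type_cons k s y r : 0 < k <= y ->
  run_type y r.+1 k (k :: s) =
  (\max_(l <- s) l <= k) && run_type (y - k) r (\max_(l <- s) l) s.
Proof.
case/andP=> k_gt0 le_ky; rewrite /run_type sorted_geq_cons -andbA eqxx andbT.
have [le_max | //] := boolP (\max_(l <- s) l <= k).
rewrite big_cons (maxn_idPl le_max) eqxx andbT inE eq_sym.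
rewrite -[k == 0]negbK -lt0n k_gt0 /= ltnS.
by congr [&& _, _, _ & _]; apply/eqP/eqP; lia.
Qed.

(** The empty sequence has maximum 0, and a nonincreasing one has its maximum at the head. *)
Lemma run_type_head y r k s : 0 < k -> run_type y r k s -> s = k :: behead s.
Proof.
case: s => [|a s] k_gt0; rewrite /run_type.
  by rewrite big_nil (ltn_eqF k_gt0) !andbF.
case/and5P; rewrite sorted_geq_cons => /andP[le_max _] _ _ _.
by rewrite big_cons (maxn_idPl le_max) => /eqP->.
Qed.

Theorem theorem4p4 (n x k : nat) (hxn : x < n) (hkx : k <= x) (hk : 3 <= k) :
  P n.+1 x k =
    \sum_((n - k - 1) %/ (n - x) <= j < k.+1) P (n - k) (x - k) j.
Proof.
have k_gt0 : 0 < k by lia.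
pose f (s : seq nat) := \max_(l <- behead s) l.
(* The shorter strings have length [n - k - 1], hence exactly one fewer one: a separator disappears
   together with the removed block. *)
have nxE : n - x = (n - k - 1 - (x - k)).+1 by lia.
have memL s : (s \in run_types n x k) =
    [&& s == k :: behead s, f s <= k
      & run_type (x - k) (n - k - 1 - (x - k)) (f s) (behead s)].
  rewrite mem_run_types ?(ltnW hxn) // nxE.
  apply/idP/andP => [ty_s | [/eqP -> ty_s]]; last by rewrite run_type_cons ?k_gt0.
  have sE := run_type_head _ _ _ _ k_gt0 ty_s; rewrite -sE; split=> //.
  by rewrite -run_type_cons ?k_gt0 // -sE.
rewrite P_run_types (@size_sum_count _ _ f ((n - k - 1) %/ (n - x)) k.+1).
  apply: eq_big_nat => j /andP[_ le_jk].
  have -> : n - k = (n - k - 1).+1 by lia.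
  (* For fixed [j], [cons k] is a bijection from the types of the shorter strings onto the types
     whose tail has maximum [j]. *)
  rewrite P_run_types -size_filter -(size_map (cons k)).
  apply/perm_size/uniq_perm; first by rewrite filter_uniq ?undup_uniq.
    by rewrite map_inj_uniq ?undup_uniq // => s t [].
  move=> s; rewrite mem_filter memL; apply/idP/mapP.
    case/and4P=> /eqP <- /eqP sE _ ty_s; exists (behead s) => //.
    by rewrite mem_run_types //; lia.
  case=> t; rewrite mem_run_types; last by lia.
  move=> ty_t ->; have /eqP fE : f (k :: t) == j by case/and5P: ty_t.
  by rewrite fE /= !eqxx -ltnS le_jk ty_t.
move=> s; rewrite memL => /and3P[_ le_fk /and5P[_ _ /eqP sum_s sz_s _]].
(* Since [n - k - 1 = (x - k) + (n - x) - 1], the floor is the ceiling of [(x - k) / (n - x)]. *)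
rewrite ltnS le_fk andbT -ltnS ltn_divLR; last by lia.
have := sumn_leq_size_max (behead s); rewrite sum_s -/(f s) => le_sum.
have : x - k <= (n - x) * f s.
  by apply: leq_trans le_sum _; rewrite leq_mul2r nxE sz_s orbT.
by rewrite mulSn [f s * _]mulnC; lia.
Qed.
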